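(* Fix any distribution $P$ on $\mathcal{X}\times\mathbb{R}$, any symmetric regression algorithm $\mathcal{A}$, any sample size $n\geq 1$, and any inflation parameter $\gamma>0$. Then, for any $m\geq 1$ and any $\delta \in (0,1)$, \[\mathbb{P}\left\{ \alpha_P^{\gamma\text{-CP}}(\mathcal{D}_n) < \alpha + 3\sqrt{\frac{\log(1/\delta)}{2\min\{n,m\}}} + 2\sqrt[3]{\frac{2\beta^{\mathrm{in}}_{m-1,n+1}(\mathcal{A},P)}{\gamma}} \right\} \geq 1 - 3\delta - \sqrt[3]{\frac{2\beta^{\mathrm{in}}_{m-1,n+1}(\mathcal{A},P)}{\gamma}},\] where the probability is taken with respect to $\mathcal{D}_n = \{(X_i,Y_i)\}_{i\in[n]}$ drawn i.i.d. from $P$.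
   Context: Write $[n]=\{1,\dots,n\}$. Let $\mathcal{X}$ be a measurable space. A regression algorithm is a map $\mathcal{A}:\bigcup_{n\geq 0}(\mathcal{X}\times\mathbb{R})^n\to\{\text{measurable functions }\mathcal{X}\to\mathbb{R}\}$. It is symmetric if for each $n\ge1$, each data set and each permutation $\pi$ of $[n]$, $\mathcal{A}((X_1,Y_1),\dots,(X_n,Y_n))=\mathcal{A}((X_{\pi(1)},Y_{\pi(1)}),\dots,(X_{\pi(n)},Y_{\pi(n)}))$. All quantities whose probabilities or expectations are taken are understood to be measurable. A target level $\alpha\in(0,1)$ is fixed. Quantile: for real $v_1,\dots,v_n$ and $\tau\in\mathbb{R}$, $\mathrm{Quantile}(\{v_i\}_{i\in[n]};\tau)=\inf\{t\in\mathbb{R}: \#\{i\in[n]: v_i\le t\}\ge \tau n\}$, equal to $+\infty$ if $\tau>1$. Inflated full conformal prediction: given $\mathcal{D}_n=\{(X_i,Y_i)\}_{i\in[n]}$, a test feature $X_{n+1}$ and $y\in\mathbb{R}$, let $\widehat\mu^y=\mathcal{A}((X_1,Y_1),\dots,(X_n,Y_n),(X_{n+1},y))$. For $\gamma\ge0$, the $\gamma$-inflated full conformal prediction set is \[\widehat{C}^{\gamma\text{-CP}}_n(X_{n+1})=\Big\{y\in\mathbb{R}: |y-\widehat\mu^y(X_{n+1})|\le \mathrm{Quantile}\big(\{|Y_i-\widehat\mu^y(X_i)|\}_{i\in[n]};(1-\alpha)(1+1/n)\big)+\gamma\Big\}.\] Its training-conditional miscoverage rate is $\alpha_P^{\gamma\text{-CP}}(\mathcal{D}_n)=\mathbb{P}\{Y_{n+1}\notin\widehat{C}^{\gamma\text{-CP}}_n(X_{n+1})\mid\mathcal{D}_n\}$,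 where $(X_{n+1},Y_{n+1})\sim P$ is independent of $\mathcal{D}_n$. In-sample $m$-stability: for $n\ge1$, $m\ge0$, $\beta^{\mathrm{in}}_{m,n}(\mathcal{A},P)=\mathbb{E}[|\widehat\mu_n(X_1)-\widehat\mu_{n+m}(X_1)|]$, where $\widehat\mu_k=\mathcal{A}((X_1,Y_1),\dots,(X_k,Y_k))$ and $(X_1,Y_1),\dots,(X_{n+m},Y_{n+m})$ are i.i.d. from $P$. *)

(* Defs.v *)
From HB Require Import structures.
From mathcomp Require Import all_boot all_order all_algebra all_fingroup.
From mathcomp Require Import all_classical all_reals all_analysis.
Import Order.TTheory GRing.Theory Num.Theory.

Set Implicit Arguments.
Unset Strict Implicit.
Unset Printing Implicit Defensive.

Local Open Scope classical_set_scope.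
Local Open Scope ring_scope.

Section iid_law.
Context d (T : measurableType d) (R : realType) (P : probability T R).

Definition cons_pair n (p : T * n.-tuple T) : n.+1.-tuple T :=
  [tuple of p.1 :: p.2].

Lemma measurable_cons_pair n : measurable_fun setT (@cons_pair n).
Proof. exact: measurable_cons measurable_fst measurable_snd. Qed.

HB.instance Definition _ n :=
  @isMeasurableFun.Build _ _ _ _ (@cons_pair n) (@measurable_cons_pair n).

(* The n-fold product P^n, i.e. the law of n i.i.d. draws from P; the product
   rule is [iid_law_box]. *)
Fixpoint iid_law n : probability (n.-tuple T) R :=
  if n is k.+1 then distribution (P \x iid_law k)%E (@cons_pair k)
  else \d_([tuple] : 0.-tuple T).

Lemma iid_law_box n (B : 'I_n -> set T) : (forall i, measurable (B i)) ->
  iid_law n [set D | forall i, B i (tnth D i)] = (\prod_(i < n) P (B i))%E.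
Proof.
elim: n B => [|n IHn] B mB.
  rewrite big_ord0 /= diracE mem_set//.
  by case.
pose C := [set D : n.-tuple T | forall i, B (lift ord0 i) (tnth D i)].
have mC : measurable C.
  rewrite [C](_ : _ = \bigcap_(i in setT) ((@tnth n T ^~ i) @^-1` B (lift ord0 i))).
    apply: fin_bigcap_measurable => // i _.
    by rewrite -[X in measurable X]setTI; exact: measurable_tnth.
  by apply/seteqP; split => D /= h i; [move=> _; exact: h | exact: h].
rewrite big_ord_recl -[X in (_ * X)%E]IHn// -product_measure1E//=.
rewrite /distribution /pushforward; congr (product_measure1 _ _ _).
apply/seteqP; split => -[x D] /=.
  move=> h; split; first exact: (h ord0).
  by move=> i; have := h (lift ord0 i); rewrite tnthS.
move=> [hx hD] i; case: (unliftP ord0 i) => [j|] ->; last exact: hx.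
by rewrite tnthS; exact: hD.
Qed.

End iid_law.

Section conformal.
Context d (X : measurableType d) (R : realType).

(* A data set is a finite sequence over X * R, so [seq (X * R)] is the disjoint
   union over n >= 0 of the (X * R)^n. *)
Definition algorithm := seq (X * R) -> {mfun X >-> R}.

Implicit Types (A : algorithm) (P : probability (X * R)%type R).

Definition symmetric_algorithm A :=
  forall n (D : n.-tuple (X * R)) (s : 'S_n), (0 < n)%N ->
    A [tuple tnth D (s i) | i < n] = A D :> (X -> R).

(* The only regularity in the data that the measurability convention requires:
   every fitted value hat-mu_n(X_i) is a random variable.  It makes the
   miscoverage event, the miscoverage rate and the integrand of beta^in
   measurable, and is weaker than joint measurability of (D, x) |-> A(D)(x). *)
Definition measurable_fits A :=
  forall n (i : 'I_n),
    measurable_fun setT (fun D : n.-tuple (X * R) => A D (tnth D i).1).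

(* +oo when no t qualifies, i.e. when 0 < n and 1 < tau *)
Definition Quantile n (v : 'I_n -> R) (tau : R) : \bar R :=
  ereal_inf [set t%:E | t in
    [set t : R | tau * n%:R <= #|[pred i | v i <= t]|%:R]].

Definition conformal_set A (alpha gamma : R) n (D : n.-tuple (X * R)) (x : X)
    : set R :=
  [set y | let mu := A (rcons D (x, y)) in
    ((`|y - mu x|%R)%:E <=
     Quantile (fun i : 'I_n => `|(tnth D i).2 - mu (tnth D i).1|)%R
              ((1 - alpha) * (1 + n%:R^-1))%R + gamma%:E)%E].

(* Since (X_{n+1}, Y_{n+1}) ~ P is independent of D_n, conditioning on D_n = D
   amounts to taking the P-measure with D fixed. *)
Definition miscoverage P A (alpha gamma : R) n (D : n.-tuple (X * R)) : \bar R :=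
  P [set z | ~ conformal_set A alpha gamma D z.1 z.2].

(* beta^in_{m,n}, for 1 <= n (junk value 0 when n = m = 0) *)
Definition beta_in A P m n : \bar R :=
  (\int[iid_law P (n + m)]_D
     (if tval D is z1 :: _ then `|A (take n D) z1.1 - A D z1.1|%R%:E else 0))%E.

End conformal.

(* Main.v *)
Require Import Defs.
From HB Require Import structures.
From mathcomp Require Import all_boot all_order all_algebra all_fingroup.
From mathcomp Require Import all_classical all_reals all_analysis.
From mathcomp Require Import measurable_realfun ring lra.
Import Order.TTheory GRing.Theory Num.Theory.
Import numFieldNormedType.Exports.

(** Draw [m] test points besides the [n] training points, and compare each
    conformal fit, which uses the training points and one test point, with the
    full fit on all [N = n + m] points. Write [e] for the cube root in the theorem
    and [s] for its square root.

    The full fit is symmetric in the [N] points, so its residuals are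
    exchangeable. A test point [j] is missed by the conformal set exactly when, for
    the conformal fit, its residual exceeds by more than [gamma] those of at least
    [(1 - alpha) * (n + 1)] training points ([missedP]). Replacing the conformal
    fit by the full fit can undo such a comparison with training point [i] only
    when the changes of the fitted values at [i] and at [j] add up to at least
    [gamma]; call the pair unstable. By symmetry each change has expectation
    [beta_in], so Markov's inequality bounds the probability of an unstable pair by
    [e ^+ 3] ([unstable_le]). A second use of it shows that, outside an event of
    probability at most [e], unstable pairs make up a proportion at most [e ^+ 2] of
    all pairs, and then at most a fraction [e] of the test points has more than
    [e * n] unstable partners ([many_unstable_le], [card_heavy_le]).

    Every other missed test point has a full residual that at most
    [(alpha + e) * n] training points reach. Both samples are drawn without
    replacement from the pooled residuals, so with [p = alpha + e + s], and outside
    two events of probability at most [delta] each, the proportion of training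
    points outside the top [p * N] pooled residuals is less than [1 - p + s], and
    that of test points inside it is less than [p + s]. Hence the fraction of such
    test points is below [alpha + e + 2 * s] ([card_test_exceed_lt]). Finally, given the training set the
    test points are missed independently with probability equal to the miscoverage
    rate, which is therefore less than the observed frequency plus [s], outside a
    third event of probability at most [delta] ([many_test_covered_le]).

    The three concentration bounds come from a single inequality,
    [negative_chernoff], about events whose joint probabilities are at most those of
    independent events of probability [p]. For sampling without replacement this
    hypothesis is [exchangeable_inter_le]. *)

Set Implicit Arguments.
Unset Strict Implicit.
Unset Printing Implicit Defensive.

Local Open Scope classical_set_scope.
Local Open Scope ring_scope.

(** * Concentration of sums of indicators *)

Section measurable_comparison.
Context d (T : measurableType d) (R : realType).
Implicit Types f g : T -> R.

Lemma measurable_bool_set (b : T -> bool) :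
  measurable_fun setT b -> measurable [set w | b w].
Proof.
move=> mb; rewrite (_ : [set w | b w] = setT `&` b @^-1` [set true]).
  exact: mb.
by apply/seteqP; split => w //= -[].
Qed.

Lemma measurable_le_set f g : measurable_fun setT f -> measurable_fun setT g ->
  measurable [set w | f w <= g w].
Proof. by move=> mf mg; apply: measurable_bool_set; exact: measurable_fun_ler. Qed.

Lemma measurable_lt_set f g : measurable_fun setT f -> measurable_fun setT g ->
  measurable [set w | f w < g w].
Proof. by move=> mf mg; apply: measurable_bool_set; exact: measurable_fun_ltr. Qed.

Lemma measurable_count_le (I : finType) (B : I -> set T) (c : R) :
  (forall i, measurable (B i)) ->
  measurable [set w | c <= \sum_i \1_(B i) w].
Proof.
move=> mB; apply: measurable_le_set => //.
by apply: measurable_sum => i; exact: measurable_indic.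
Qed.

Lemma measurable_forall_in (I : finType) (B : I -> set T) (J : {set I}) :
  (forall i, measurable (B i)) ->
  measurable [set w | forall i, i \in J -> B i w].
Proof.
move=> mB; rewrite (_ : [set _ | _] = \bigcap_(i in [set` J]) B i).
  by apply: fin_bigcap_measurable => //; exact: finite_finset.
by apply/seteqP; split.
Qed.

End measurable_comparison.

Lemma sum_indic_card (T : Type) (R : realType) (I : finType) (b : I -> T -> bool) w :
  \sum_i \1_[set w | b i w] w = #|[pred i | b i w]|%:R :> R.
Proof.
rewrite -sum1_card natr_sum [RHS]big_mkcond/=; apply: eq_bigr => i _.
rewrite indicE inE (_ : (w \in _) = b i w) ?mulrb; first by case: (b i w).
by apply/idP/idP; rewrite in_setE.
Qed.

Lemma markov_count d (T : measurableType d) (R : realType) (Q : probability T R)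
    (I : finType) (B : I -> set T) (c q : R) :
  (forall i, measurable (B i)) -> 0 < c ->
  (forall i, (Q (B i) <= q%:E)%E) ->
  (Q [set w | (c <= \sum_i \1_(B i) w)%R] <= (c^-1 * (#|I|%:R * q))%:E)%E.
Proof.
move=> mB c0 QB; rewrite EFinM lee_pdivlMl//.
pose f w : R := \sum_i \1_(B i) w.
have f0 w : 0 <= f w by exact: sumr_ge0.
have mf : measurable_fun setT (EFin \o f).
  by apply/measurable_EFinP; apply: measurable_sum => i; exact: measurable_indic.
have := @le_integral_abse _ _ _ Q _ measurableT _ _ mf c0; rewrite setTI.
rewrite (_ : [set w | (c%:E <= `|(EFin \o f) w|)%E] = [set w | c <= f w]); last first.
  by apply/seteqP; split => w /=; rewrite lee_fin ger0_norm.
move=> /le_trans; apply.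
under eq_integral do rewrite /= ger0_norm// /f -sumEFin.
rewrite ge0_integral_sum//; last first.
  by move=> i; apply/measurable_EFinP; exact: measurable_indic.
rewrite mulr_natl -sumr_const -sumEFin; apply: lee_sum => i _.
rewrite integral_indic// setIT; exact: QB.
Qed.

(** Hoeffding's lemma for a Bernoulli variable. With [u x] the moment generating
    function at [x], the log-ratio [g] of the two sides satisfies
    [g 0 = g' 0 = 0], and [g'' = 1/4 - q (1 - q) >= 0] where [q] is the success
    probability of the exponentially tilted variable. *)
Lemma bernoulli_mgf_le (R : realType) (p l : R) : 0 <= p <= 1 -> 0 <= l ->
  1 + p * (expR l - 1) <= expR (l * p + l ^+ 2 / 8).
Proof.
move=> /andP[p0 p1] l0.
pose u : R -> R := cst (1 - p) + p *: @expR R.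
have uE x : u x = 1 + p * (expR x - 1).
  by rewrite /u -[LHS]/(1 - p + p * expR x); ring.
have u_gt0 x : 0 < u x.
  have := expR_gt0 x; rewrite uE; have [->|p1'] := eqVneq p 1; first by lra.
  have : p < 1 by rewrite lt_neqAle p1'.
  by move=> ? ?; nra.
have uD (x : R) : is_derive x (1 : R) u (p * expR x).
  apply: (is_derive_eq (is_deriveD (is_derive_cst _ _ _)
    (is_deriveZ p (is_derive_expR x)))).
  by rewrite add0r.
have iuD (x : R) : is_derive x (1 : R) (fun y => (u y)^-1) (- (u x) ^- 2 *: (p * expR x)).
  by apply: is_deriveV; rewrite gt_eqF.
have lnuD (x : R) : is_derive x (1 : R) (@ln R \o u) ((u x)^-1 * (p * expR x)).
  by apply: is_derive1_comp; apply: is_derive1_ln.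
(* success probability of the tilted variable *)
pose q (x : R) := p * expR x / u x.
pose h : R -> R := cst p + 4^-1 *: id - p *: (@expR R * (fun y => (u y)^-1)).
pose g : R -> R := p *: id + 8^-1 *: (id * id) - (@ln R \o u).
have hE x : h x = p + x / 4 - q x.
  by rewrite -[LHS]/(p + 4^-1 * x - p * (expR x * (u x)^-1)) /q; ring.
have gE x : g x = x * p + x ^+ 2 / 8 - ln (u x).
  by rewrite -[LHS]/(p * x + 8^-1 * (x * x) - ln (u x)); ring.
have hD (x : R) : is_derive x (1 : R) h (4^-1 - q x * (1 - q x)).
  have ux0 := lt0r_neq0 (u_gt0 x).
  apply: (is_derive_eq (is_deriveB
    (is_deriveD (is_derive_cst _ _ _) (is_deriveZ _ (is_derive_id _ _)))
    (is_deriveZ p (is_deriveM (is_derive_expR x) (iuD x))))).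
  by rewrite /q /GRing.scale/=; field.
have gD (x : R) : is_derive x (1 : R) g (h x).
  apply: (is_derive_eq (is_deriveB
    (is_deriveD (is_deriveZ p (is_derive_id _ _))
      (is_deriveZ _ (is_deriveM (is_derive_id _ _) (is_derive_id _ _))))
    (lnuD x))).
  by rewrite hE /q /GRing.scale/=; field; exact: lt0r_neq0.
have cf (f f' : R -> R) : (forall x : R, is_derive x (1 : R) f (f' x)) ->
    {within `[0, l], continuous f}.
  move=> fD; apply: continuous_subspaceT => x.
  apply: differentiable_continuous; apply/derivable1_diffP.
  by case: (fD x).
have h_ge0 x : x \in `]0, l[ -> 0 <= h x.
  rewrite in_itv/= => /andP[x0 xl].
  have h0 : h 0 = 0 by rewrite hE /q uE expR0; field.
  rewrite -h0; apply: (@ger0_derive1_ndecr _ h 0 l) => //.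
  - move=> y _; rewrite derive1E (@derive_val _ _ _ _ _ _ _ (hD y)) subr_ge0.
    have := sqr_ge0 (q y - 2^-1); rewrite expr2; lra.
  - exact: cf hD.
  - exact: ltW.
  - exact: ltW.
have : g 0 <= g l.
  apply: (@ger0_derive1_ndecr _ g 0 l) => //.
  - by move=> y yl; rewrite derive1E (@derive_val _ _ _ _ _ _ _ (gD y)); exact: h_ge0.
  - exact: cf gD.
rewrite !gE uE expR0 subrr mulr0 addr0 ln1 => gl.
rewrite -uE -[u l]lnK ?posrE// ler_expR; lra.
Qed.

Section chernoff.
Context d (T : measurableType d) (R : realType) (Q : probability T R).
Context (I : finType) (B : I -> set T).
Hypothesis mB : forall i, measurable (B i).

Let inter (J : {set I}) : set T := [set w | forall i, i \in J -> B i w].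

Let minter J : measurable (inter J). Proof. exact: measurable_forall_in. Qed.

Let indic_inter (J : {set I}) w : \prod_(i in J) \1_(B i) w = \1_(inter J) w :> R.
Proof.
rewrite [RHS]indicE; have [/set_mem Jw|/negP Jw] := boolP (w \in inter J).
  by rewrite big1// => i iJ; rewrite indicE mem_set//; exact: Jw.
have [i iJ Bi] : exists2 i, i \in J & ~ B i w.
  apply: contrapT => h; apply: Jw; apply/mem_set => i iJ.
  by apply: contrapT => Bi; apply: h; exists i.
by rewrite (bigD1 i)//= indicE memNset// mul0r.
Qed.

Let prod_expand (x : R) w :
  \prod_i (1 + x * \1_(B i) w) = \sum_(J : {set I}) x ^+ #|J| * \1_(inter J) w.
Proof.
under eq_bigr do rewrite addrC.
rewrite bigA_distr; apply: eq_bigr => J _.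
rewrite -indic_inter -prodr_const -big_split/= [RHS]big_mkcond/=.
by apply: eq_bigr => i _; case: ifP.
Qed.

(** Hoeffding's bound needs independence only through the moment generating
    function: expanding the product of the [1 + x * \1_(B i)] over subsets [J]
    writes it as a combination, with nonnegative weights [x ^+ #|J|], of the
    probabilities of joint occurrence. Bounding these by [p ^+ #|J|] therefore
    bounds it by the moment generating function of a binomial variable. This
    covers independent trials and sampling without replacement alike. *)
Lemma negative_chernoff (p s : R) : 0 <= p <= 1 -> 0 <= s ->
  (forall J : {set I},
     Q [set w | forall i, i \in J -> B i w] <= (p ^+ #|J|)%:E)%E ->
  (Q [set w | ((p + s) * #|I|%:R <= \sum_i \1_(B i) w)%R] <=
   (expR (- (2 * s ^+ 2 * #|I|%:R)))%:E)%E.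
Proof.
move=> p01 s0 QB; have /andP[p0 p1] := p01.
have [->|sn0] := eqVneq s 0.
  by rewrite expr0n/= mulr0 mul0r oppr0 expR0 probability_le1//; exact: measurable_count_le.
have {sn0}s_gt0 : 0 < s by rewrite lt_neqAle eq_sym sn0.
(* 4 * s minimises - l * s + l ^+ 2 / 8. *)
pose l := 4 * s; have l_gt0 : 0 < l by rewrite mulr_gt0.
have l0 := ltW l_gt0.
pose x := expR l - 1.
have x0 : 0 <= x by rewrite subr_ge0 -expR0 ler_expR.
pose f w : R := \prod_i (1 + x * \1_(B i) w).
pose a := expR (l * ((p + s) * #|I|%:R)).
have fE w : f w = expR (l * \sum_i \1_(B i) w).
  rewrite mulr_sumr expR_sum; apply: eq_bigr => i _.
  rewrite indicE; case: (_ \in _); rewrite ?mulr1 ?mulr0 ?expR0 ?addr0//.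
  by rewrite addrC subrK.
have mf : measurable_fun setT f.
  rewrite (_ : f = fun w => \sum_(J : {set I}) x ^+ #|J| * \1_(inter J) w); last first.
    by apply/funext => w; exact: prod_expand.
  by apply: measurable_sum => J; apply: measurable_funM => //; exact: measurable_indic.
have Ef : (\int[Q]_w (f w)%:E <= ((1 + p * x) ^+ #|I|)%:E)%E.
  under eq_integral do rewrite /f prod_expand -sumEFin.
  rewrite ge0_integral_sum//; last 2 first.
    by move=> J; apply/measurable_EFinP; apply: measurable_funM => //; exact: measurable_indic.
    by move=> J w _; rewrite lee_fin mulr_ge0// exprn_ge0.
  rewrite -prodr_const.
  rewrite (_ : (\prod_(i in I) _)%R = \sum_(J : {set I}) x ^+ #|J| * p ^+ #|J|)%R; last first.
    under eq_bigr do rewrite addrC.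
    rewrite bigA_distr; apply: eq_bigr => J _.
    by rewrite -exprMn -prodr_const [RHS]big_mkcond/= mulrC.
  rewrite -sumEFin; apply: lee_sum => J _.
  under eq_integral do rewrite EFinM.
  rewrite ge0_integralZl_EFin//; last 2 first.
    by apply/measurable_EFinP; exact: measurable_indic.
    exact: exprn_ge0.
  rewrite integral_indic// setIT EFinM lee_wpmul2l//; last exact: QB.
  by rewrite lee_fin exprn_ge0.
have a0 : 0 < a by exact: expR_gt0.
have mF : measurable_fun setT (EFin \o f) by exact/measurable_EFinP.
have := @le_integral_abse _ _ _ Q _ measurableT _ _ mF a0.
rewrite setTI.
have f0 w : 0 <= f w by rewrite fE expR_ge0.
rewrite (_ : [set w | (a%:E <= `|(EFin \o f) w|)%E] =
    [set w | (p + s) * #|I|%:R <= \sum_i \1_(B i) w]); last first.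
  by apply/seteqP; split => w /=; rewrite lee_fin ger0_norm// fE ler_expR ler_pM2l.
under eq_integral do rewrite /= ger0_norm//.
move=> /le_trans /(_ Ef); rewrite -lee_pdivlMl// => /le_trans; apply.
rewrite lee_fin /a -expRN.
apply: (@le_trans _ _ (expR (- (l * ((p + s) * #|I|%:R))) *
    expR (l * p + l ^+ 2 / 8) ^+ #|I|)).
  rewrite ler_pM2l ?expR_gt0// lerXn2r ?nnegrE ?expR_ge0//.
    by rewrite addr_ge0 ?mulr_ge0.
  exact: bernoulli_mgf_le.
by rewrite -expRM_natr -expRD ler_expR /l; lra.
Qed.
End chernoff.

(** * Laws of i.i.d. samples *)

Section tuple_boxes.
Context d (T : measurableType d) (n : nat).

Definition box (B : 'I_n -> set T) : set (n.-tuple T) :=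
  [set D | forall i, B i (tnth D i)].

Lemma measurable_box (B : 'I_n -> set T) : (forall i, measurable (B i)) ->
  measurable (box B).
Proof.
move=> mB.
rewrite (_ : box B = \bigcap_(i in setT) ((@tnth n T ^~ i) @^-1` B i)).
  apply: fin_bigcap_measurable => // i _.
  by rewrite -[X in measurable X]setTI; exact: measurable_tnth.
by apply/seteqP; split => D /= h i; [move=> _; exact: h | exact: h].
Qed.

Let boxes := [set S | exists2 B : 'I_n -> set T,
  (forall i, measurable (B i)) & S = box B].

Let measurable_boxes : @measurable _ (n.-tuple T) = <<s boxes >>.
Proof.
apply/seteqP; split.
  apply: smallest_sub; first exact: smallest_sigma_algebra.
  rewrite -bigcup_seq => S [/= i _ [A mA <-]].
  apply: sub_sigma_algebra; exists (fun j => if j == i then A else setT).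
    by move=> j; case: ifP.
  rewrite setTI; apply/seteqP; split => D /=.
    by move=> AD j /=; case: eqP => // ->.
  by move=> /(_ i); rewrite eqxx.
apply: smallest_sub; first exact: sigma_algebra_measurable.
by move=> _ [B mB ->]; exact: measurable_box.
Qed.

(** Boxes form a pi-system that generates the sigma-algebra on tuples, so every
    identity between laws of samples below reduces to the product rule
    [iid_law_box]. *)
Lemma box_measure_unique (R : realType) (mu nu : probability (n.-tuple T) R) :
  (forall B, (forall i, measurable (B i)) -> mu (box B) = nu (box B)) ->
  forall S, measurable S -> mu S = nu S.
Proof.
move=> eq_box S mS.
have boxT : box (fun=> setT) = setT by apply/seteqP; split.
apply: (@measure_unique _ _ _ boxes (fun=> setT) measurable_boxes) => //.
- move=> _ _ [B mB ->] [C mC ->]; exists (fun i => B i `&` C i).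
    by move=> i; exact: measurableI.
  apply/seteqP; split => D /=; first by move=> [BD CD] i; split.
  by move=> BCD; split => i; have [] := BCD i.
- by move=> _; exists (fun=> setT).
- by rewrite bigcup_const.
- by move=> _ [B mB ->]; exact: eq_box.
- by move=> _; exact: fin_num_fun_lty.
Qed.

End tuple_boxes.

Section iid_law_theory.
Context d (T : measurableType d) (R : realType) (P : probability T R).

Definition reindex_tuple n m (f : 'I_m -> 'I_n) (D : n.-tuple T) : m.-tuple T :=
  [tuple tnth D (f i) | i < m].

Lemma measurable_reindex_tuple n m (f : 'I_m -> 'I_n) :
  measurable_fun setT (reindex_tuple f).
Proof.
apply/measurable_fun_tnthP => i.
rewrite (_ : _ \o _ = (@tnth n T ^~ (f i))); first exact: measurable_tnth.
by apply/funext => D /=; rewrite tnth_mktuple.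
Qed.

HB.instance Definition _ n m (f : 'I_m -> 'I_n) :=
  @isMeasurableFun.Build _ _ _ _ (reindex_tuple f) (measurable_reindex_tuple f).

(** Permuting the coordinates of a box only permutes the factors of its
    probability. *)
Lemma iid_law_reindex n (s : 'S_n) S : measurable S ->
  iid_law P n (reindex_tuple s @^-1` S) = iid_law P n S.
Proof.
move=> mS.
rewrite -[LHS]/(distribution (iid_law P n) (reindex_tuple s) S).
apply: box_measure_unique => // B mB.
rewrite /distribution/= /pushforward [RHS]iid_law_box// (reindex_inj (@perm_inj _ s^-1%g)).
rewrite -(iid_law_box P (B := fun i => B ((s^-1)%g i)))//.
congr (iid_law P n _); apply/seteqP; split => D /= h i.
  by have := h ((s^-1)%g i); rewrite tnth_mktuple permKV.
by rewrite tnth_mktuple; have := h (s i); rewrite permK.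
Qed.

Definition cat_pair n m (p : n.-tuple T * m.-tuple T) : (n + m).-tuple T :=
  [tuple of p.1 ++ p.2].

Lemma measurable_cat_pair n m : measurable_fun setT (@cat_pair n m).
Proof.
apply/measurable_fun_tnthP => i.
case: (split_ordP i) => j ->.
  rewrite (_ : _ \o _ = (@tnth n T ^~ j) \o fst).
    by apply: measurableT_comp => //; exact: measurable_tnth.
  by apply/funext => D /=; rewrite tnth_lshift.
rewrite (_ : _ \o _ = (@tnth m T ^~ j) \o snd).
  by apply: measurableT_comp => //; exact: measurable_tnth.
by apply/funext => D /=; rewrite tnth_rshift.
Qed.

HB.instance Definition _ n m :=
  @isMeasurableFun.Build _ _ _ _ (@cat_pair n m) (@measurable_cat_pair n m).

(** Both laws give a box the product of the probabilities of its sides. This is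
    what allows conditioning on the training set. *)
Lemma iid_law_cat n m S : measurable S ->
  iid_law P (n + m) S =
  (iid_law P n \x iid_law P m)%E (@cat_pair n m @^-1` S).
Proof.
move: S; pose nu : probability ((n + m).-tuple T) R :=
  distribution (iid_law P n \x iid_law P m)%E (@cat_pair n m).
apply: (@box_measure_unique _ _ _ _ _ nu) => B mB.
rewrite [LHS]iid_law_box// big_split_ord/=.
rewrite -(iid_law_box P (B := fun i => B (lshift m i)))//.
rewrite -[X in (_ * X)%E](iid_law_box P (B := fun i => B (rshift n i)))//.
rewrite -product_measure1E; last 2 first.
  exact: (@measurable_box _ _ _ (fun i => B (lshift m i))).
  exact: (@measurable_box _ _ _ (fun i => B (rshift n i))).
rewrite /distribution/= /pushforward; congr (product_measure1 _ _ _).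
apply/seteqP; split => -[D1 D2] /=.
  move=> [h1 h2] i; case: (split_ordP i) => j -> /=.
    by rewrite tnth_lshift; exact: h1.
  by rewrite tnth_rshift; exact: h2.
move=> h; split => i.
  by have := h (lshift m i); rewrite tnth_lshift.
by have := h (rshift n i); rewrite tnth_rshift.
Qed.

End iid_law_theory.

Section iid_integral.
Context d (T : measurableType d) (R : realType) (P : probability T R).

Lemma ge0_integral_iid_reindex n (s : 'S_n) (f : n.-tuple T -> \bar R) :
  measurable_fun setT f -> (forall D, 0 <= f D)%E ->
  (\int[iid_law P n]_D f (reindex_tuple s D) = \int[iid_law P n]_D f D)%E.
Proof.
move=> mf f0.
rewrite -[LHS](ge0_integral_distribution (P := iid_law P n) (reindex_tuple s) mf f0).
by apply: eq_measure_integral => S mS _; exact: iid_law_reindex.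
Qed.

Lemma iid_law_lshift n m (S : set (n.-tuple T)) : measurable S ->
  iid_law P (n + m) (reindex_tuple (@lshift n m) @^-1` S) = iid_law P n S.
Proof.
move=> mS; rewrite iid_law_cat; last first.
  by rewrite -[X in measurable X]setTI; exact: measurable_reindex_tuple.
rewrite (_ : _ @^-1` _ = S `*` setT).
  transitivity (iid_law P n S * iid_law P m setT)%E.
    exact: product_measure1E.
  by rewrite probability_setT mule1.
apply/seteqP; split => -[D1 D2] /=.
  by move=> SD; split => //; move: SD; congr S; apply: eq_from_tnth => i;
     rewrite tnth_mktuple tnth_lshift.
by move=> [SD _]; move: SD; congr S; apply: eq_from_tnth => i;
   rewrite tnth_mktuple tnth_lshift.
Qed.

End iid_integral.

(** * Sampling without replacement *)

Section exchangeable.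
Context d (T : measurableType d) (R : realType) (P : probability T R).
Context (N : nat) (b : 'I_N -> set (N.-tuple T)) (p : R).
Hypothesis mb : forall i, measurable (b i).
Hypothesis b_equivariant : forall (s : 'S_N) i D, b i (reindex_tuple s D) <-> b (s i) D.
Hypothesis b_count : forall D, \sum_i \1_(b i) D <= p * N%:R.
Hypothesis p01 : 0 <= p <= 1.

Let inter (J : {set 'I_N}) : set (N.-tuple T) := [set D | forall i, i \in J -> b i D].

Let minter J : measurable (inter J). Proof. exact: measurable_forall_in. Qed.

(** A family of events that is permuted along with the sample, of which at most
    [p * N] occur at a time, behaves like draws without replacement: given that
    [k] of them occur, a further one has probability at most
    [(p * N - k) / (N - k) <= p]. By exchangeability all further events are
    equally likely given the first [k], so it suffices to sum over them. *)
Lemma exchangeable_inter_le (J : {set 'I_N}) :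
  (iid_law P N [set D | forall i, i \in J -> b i D] <= (p ^+ #|J|)%:E)%E.
Proof.
have /andP[p0 p1] := p01.
move: J; suff H k (J : {set 'I_N}) : #|J| = k -> (iid_law P N (inter J) <= (p ^+ k)%:E)%E.
  by move=> J; exact: H.
elim: k J => [J _|k IH J Jk].
  by rewrite expr0 probability_le1.
have /card_gt0P[i0 i0J] : (0 < #|J|)%N by rewrite Jk.
pose J' := J :\ i0.
have J'k : #|J'| = k by have := cardsD1 i0 J; rewrite i0J Jk => -[].
pose q i : R := fine (iid_law P N (inter J' `&` b i)).
pose K : R := fine (iid_law P N (inter J')).
have mIb i : measurable (inter J' `&` b i) by exact: measurableI.
have qE i : (q i)%:E = iid_law P N (inter J' `&` b i) by rewrite fineK// fin_num_measure.
have KE : K%:E = iid_law P N (inter J') by rewrite fineK// fin_num_measure.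
have qin i : i \in J' -> q i = K.
  move=> iJ'; rewrite /q /K; congr (fine (iid_law P N _)).
  by apply/seteqP; split => D /=; [case|move=> h; split => //; exact: h].
(* transposing i and i0 fixes J' and exchanges the two events *)
have qout i : i \notin J' -> q i = q i0.
  move=> iJ'; rewrite /q -(iid_law_reindex P (tperm i i0))//; congr (fine (iid_law P N _)).
  have tJ' j : j \in J' -> tperm i i0 j = j.
    move=> jJ'; apply: tpermD; apply: contraTneq jJ' => <- //.
    by rewrite !inE eqxx.
  apply/seteqP; split => D /= [h1 h2]; split.
  - by move=> j jJ'; have /b_equivariant := h1 _ jJ'; rewrite tJ'.
  - by have /b_equivariant := h2; rewrite tpermL.
  - by move=> j jJ'; apply/b_equivariant; rewrite tJ'//; exact: h1.
  - by apply/b_equivariant; rewrite tpermL.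
have sum_le : \sum_i q i <= p * N%:R * K.
  rewrite -lee_fin EFinM KE -sumEFin.
  rewrite -[inter J']setIT -integral_indic// -ge0_integralZl_EFin//; last 2 first.
    by apply/measurable_EFinP; exact: measurable_indic.
    by rewrite mulr_ge0.
  under eq_bigr do rewrite qE -[_ `&` b _]setIT -integral_indic//.
  rewrite -ge0_integral_sum//; last first.
    by move=> i; apply/measurable_EFinP; exact: measurable_indic.
  apply: ge0_le_integral => //.
  - by move=> D _; apply: sume_ge0 => i _; rewrite lee_fin.
  - by apply: emeasurable_sum => i; apply/measurable_EFinP; exact: measurable_indic.
  - by apply/measurable_EFinP; apply: measurable_funM => //; exact: measurable_indic.
  - move=> D _; rewrite sumEFin lee_fin.
    under eq_bigr do rewrite indicI /= mulrC.
    by rewrite -mulr_suml; apply: ler_wpM2r.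
have sumE : \sum_i q i = k%:R * K + (N - k)%:R * q i0.
  rewrite (bigID (mem J'))/=; congr (_ + _).
    by rewrite (eq_bigr (fun=> K) qin) sumr_const J'k mulr_natl.
  rewrite (eq_bigr (fun=> q i0) qout) sumr_const mulr_natl; congr (_ *+ _).
  have := cardC (mem J'); rewrite card_ord J'k => /(congr1 (subn^~ k)).
  by rewrite addKn => <-; apply: eq_card.
have kN : (k < N)%N by have := max_card (mem J); rewrite card_ord Jk.
have interJ : inter J = inter J' `&` b i0.
  apply/seteqP; split => D /=.
    by move=> h; split; [move=> i; rewrite in_setD1 => /andP[_]; exact: h|exact: h].
  move=> [h1 h2] i iJ; have [->//|ni] := eqVneq i i0.
  by apply: h1; rewrite in_setD1 ni.
have K0 : 0 <= K by rewrite fine_ge0.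
have KIH : K <= p ^+ k by rewrite -lee_fin KE; exact: IH.
rewrite interJ -qE lee_fin exprS; apply: (@le_trans _ _ (p * K)); last first.
  by rewrite ler_wpM2l.
have Nk0 : 0 < (N - k)%:R :> R by rewrite ltr0n subn_gt0.
rewrite -(ler_pM2l Nk0).
move: sum_le; rewrite sumE natrB 1?ltnW// => H.
have : 0 <= k%:R * K * (1 - p) by rewrite !mulr_ge0// subr_ge0.
lra.
Qed.

End exchangeable.

(** The events at the positions [g i] are draws without replacement, to which
    [negative_chernoff] applies by [exchangeable_inter_le]. *)
Lemma exchangeable_chernoff d (T : measurableType d) (R : realType)
    (P : probability T R) (N : nat) (b : 'I_N -> set (N.-tuple T)) (p s : R)
    (k : nat) (g : 'I_k -> 'I_N) :
  (forall i, measurable (b i)) ->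
  (forall (t : 'S_N) i D, b i (reindex_tuple t D) <-> b (t i) D) ->
  (forall D, \sum_i \1_(b i) D <= p * N%:R) ->
  0 <= p <= 1 -> 0 <= s -> injective g ->
  (iid_law P N [set D | ((p + s) * k%:R <= \sum_(i < k) \1_(b (g i)) D)%R] <=
   (expR (- (2 * s ^+ 2 * k%:R)))%:E)%E.
Proof.
move=> mb beq bcount p01 s0 ginj.
have := @negative_chernoff _ _ _ (iid_law P N) _ (b \o g) (fun i => mb (g i)) p s p01 s0.
rewrite card_ord; apply => // J.
rewrite -(card_imset _ ginj).
rewrite (_ : [set D | forall i, i \in J -> _] =
   [set D | forall i, i \in g @: J -> b i D]); first exact: exchangeable_inter_le.
apply/seteqP; split => D /= h i; first by move=> /imsetP[x xJ ->]; exact: h.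
by move=> iJ; apply: h; exact: imset_f.
Qed.

(** * Ranks and quantiles *)

Section counting.
Context (R : realType).

(** All counted points lie at or above the lowest of them, so the rank of that one
    bounds their number. *)
Lemma card_upper_rank_le (I : finType) (r : I -> R) (c : R) : 0 <= c ->
  #|[pred k | #|[pred l | r k <= r l]|%:R <= c]|%:R <= c.
Proof.
move=> c0; set U := [pred k | _].
have [k0 k0U|U0] := pickP U; last by rewrite (eq_card0 U0).
case: (arg_minP r k0U) => k kU kmin.
apply: le_trans kU; rewrite ler_nat; apply: subset_leq_card.
by apply/fintype.subsetP => l lU; exact: kmin.
Qed.

(** No counted point lies strictly above the highest of them. *)
Lemma card_lower_rank_le (I : finType) (r : I -> R) (c : R) : c <= #|I|%:R ->
  #|[pred k | c <= #|[pred l | r k < r l]|%:R]|%:R <= #|I|%:R - c.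
Proof.
move=> cI; set L := [pred k | _].
have [k0 k0L|L0] := pickP L; last by rewrite (eq_card0 L0) subr_ge0.
case: (arg_maxP r k0L) => k kL kmax.
rewrite lerBrDl; apply: le_trans (lerD kL (lexx _)) _.
rewrite -natrD ler_nat -(cardC [pred l | r k < r l]) leq_add2l.
by apply: subset_leq_card; apply/fintype.subsetP => l lL; rewrite !inE -leNgt; exact: kmax.
Qed.

(** A test value in the upper [(p - s)]-part of the training sample that were not
    among the top [p * (n + m)] pooled values would put every smaller training
    value outside that top too, hence at least [(1 - p + s) * n] of them. So it
    is among the top pooled values, of which the test sample has few. Counting
    with [<=] for the test ranks and with [<] for the training ranks
    makes the argument insensitive to ties. *)
Lemma card_test_exceed_lt n m (r : 'I_(n + m) -> R) (p s : R) :
  #|[pred j : 'I_m |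
     #|[pred l | r (rshift n j) <= r l]|%:R <= p * (n + m)%:R]|%:R
    < (p + s) * m%:R ->
  #|[pred i : 'I_n |
     p * (n + m)%:R <= #|[pred l | r (lshift m i) < r l]|%:R]|%:R
    < (1 - p + s) * n%:R ->
  #|[pred j : 'I_m |
     #|[pred i : 'I_n | r (rshift n j) <= r (lshift m i)]|%:R <= (p - s) * n%:R]|%:R
    < (p + s) * m%:R.
Proof.
move=> upper lower; apply: le_lt_trans upper; rewrite ler_nat.
apply: subset_leq_card; apply/fintype.subsetP => j; rewrite !inE => jtop.
rewrite leNgt; apply/negP => jN; move: lower; apply/negP; rewrite -leNgt.
have -> : (1 - p + s) * n%:R = n%:R - (p - s) * n%:R by ring.
rewrite lerBlDl; apply: le_trans (lerD jtop (lexx _)).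
rewrite -natrD ler_nat.
rewrite -[X in (X <= _)%N](card_ord n) -(cardC [pred i : 'I_n | r (rshift n j) <= r (lshift m i)]).
rewrite leq_add2l; apply: subset_leq_card; apply/fintype.subsetP => i.
rewrite !inE -ltNge => ij; apply/ltW/(lt_le_trans jN).
rewrite ler_nat; apply: subset_leq_card; apply/fintype.subsetP => l; rewrite !inE.
exact: lt_le_trans.
Qed.

(** Order comparisons with margin [g] survive a perturbation, except at the
    indices where the perturbations of the two values add up to [g] or more.
    Charging the two perturbations together, rather than asking each to be below
    [g / 2], is what makes a single application of Markov's inequality enough in
    [unstable_le]. *)
Lemma card_exceed_perturb n (r r' : 'I_n -> R) (t t' : R) (D : 'I_n -> R) (D0 g a e : R) :
  (forall i, `|r i - r' i| <= D i) -> `|t - t'| <= D0 ->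
  (1 - a) * n.+1%:R <= #|[pred i | r i + g < t]|%:R ->
  0 <= 1 - a ->
  #|[pred i | g <= D i + D0]|%:R <= e * n%:R ->
  #|[pred i | t' <= r' i]|%:R <= (a + e) * n%:R.
Proof.
move=> rD tD miss a1 bad.
have below : (#|[pred i | (r' i < t')%R]| + #|[pred i | (t' <= r' i)%R]| = n)%N.
  rewrite -[RHS](card_ord n) -(cardC [pred i : 'I_n | (r' i < t')%R]); congr addn.
  by apply: eq_card => i; rewrite !inE -leNgt.
have H : (#|[pred i | (r i + g < t)%R]| + #|[pred i | (t' <= r' i)%R]| <=
    n + #|[pred i | (g <= D i + D0)%R]|)%N.
  rewrite -[X in (_ <= X + _)%N]below.
  rewrite addnAC leq_add2r.
  rewrite -cardUI (leq_trans _ (leq_addr _ _))//.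
  apply: subset_leq_card; apply/fintype.subsetP => i; rewrite !inE => ri.
  rewrite -implyNb -leNgt; apply/implyP => ri'.
  have := rD i; have := tD; rewrite !ler_norml; lra.
move: H; rewrite -(ler_nat R) !natrD => H.
have : (1 - a) * n.+1%:R = (1 - a) * n%:R + (1 - a) by rewrite -natr1; ring.
lra.
Qed.

End counting.

(** When the quantile is finite it is attained at one of the values, so the strict
    inequality can be read off from a finite count. *)
Lemma Quantile_ltP (R : realType) n (v : 'I_n -> R) (tau c : R) : 0 < tau * n%:R ->
  (Quantile v tau < c%:E)%E <-> tau * n%:R <= #|[pred i | v i < c]|%:R.
Proof.
move=> tau0; split.
  move=> /ereal_inf_lt[_ [t /= tv <-]]; rewrite lte_fin => tc.
  apply: le_trans tv _; rewrite ler_nat; apply: subset_leq_card.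
  by apply/fintype.subsetP => i; rewrite !inE => /le_lt_trans; exact.
move=> tauc; have := lt_le_trans tau0 tauc; rewrite ltr0n => /card_gt0P[i0 i0c].
case: (arg_maxP v i0c) => i ic imax.
apply: (@le_lt_trans _ _ (v i)%:E); last by rewrite lte_fin.
apply: ereal_inf_lbound; exists (v i) => //=.
apply: le_trans tauc _; rewrite ler_nat; apply: subset_leq_card.
by apply/fintype.subsetP => l lc; rewrite !inE; exact: imax.
Qed.

(** Each counted row contributes more than [e * n] to the sum. For [e = 0] this
    carries no information, but then all rows vanish. *)
Lemma card_heavy_le (R : realType) n m (a : 'I_m -> R) (e : R) : (0 < n)%N -> 0 <= e ->
  (forall j, 0 <= a j) -> \sum_j a j <= e ^+ 2 * (m%:R * n%:R) ->
  #|[pred j | e * n%:R < a j]|%:R <= e * m%:R.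
Proof.
move=> n0 e0 a0 suma; set H := [pred j | _].
have heavy : #|H|%:R * (e * n%:R) <= \sum_j a j.
  rewrite mulr_natl -sumr_const big_mkcond/=; apply: ler_sum => j _.
  by case: ifPn => // /ltW.
have [ez|en0] := eqVneq e 0.
  rewrite (eq_card0 (_ : H =i pred0)) ?ez ?mul0r// => j; rewrite !inE ez mul0r.
  apply/negbTE; rewrite -leNgt; apply: le_trans (_ : \sum_j a j <= 0).
    by rewrite (bigD1 j)//= lerDl sumr_ge0.
  by move: suma; rewrite ez expr0n mul0r.
have e_gt0 : 0 < e by rewrite lt_neqAle eq_sym en0.
have en_gt0 : 0 < e * n%:R by rewrite mulr_gt0// ltr0n.
rewrite -(ler_pM2r en_gt0); apply: le_trans heavy _; apply: le_trans suma _.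
by rewrite le_eqVlt; apply/orP; left; apply/eqP; ring.
Qed.

(** * Residuals and miscoverage *)

Section tuples.
Context d (T : measurableType d).

Lemma measurable_rcons_tuple d1 (T1 : measurableType d1) n
    (f : T1 -> n.-tuple T) (g : T1 -> T) :
  measurable_fun setT f -> measurable_fun setT g ->
  measurable_fun setT (fun w => [tuple of rcons (f w) (g w)]).
Proof.
move=> /measurable_fun_tnthP mf mg; apply/measurable_fun_tnthP => i.
have [ni|ni] := ltnP i n.
  rewrite (_ : _ \o _ = (@tnth n T ^~ (Ordinal ni)) \o f); first exact: mf.
  apply/funext => w /=.
  by rewrite (tnth_nth (g w)) [RHS](tnth_nth (g w))/= nth_rcons size_tuple ni.
rewrite (_ : _ \o _ = g)//; apply/funext => w /=.
rewrite (tnth_nth (g w))/= nth_rcons size_tuple ltnNge ni/=.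
by case: eqP.
Qed.

Lemma tnth_rcons_widen n (D : n.-tuple T) (z : T) (i : 'I_n) :
  tnth [tuple of rcons D z] (widen_ord (leqnSn n) i) = tnth D i.
Proof. by rewrite (tnth_nth z) [RHS](tnth_nth z)/= nth_rcons size_tuple ltn_ord. Qed.

Lemma tnth_rcons_max n (D : n.-tuple T) (z : T) :
  tnth [tuple of rcons D z] ord_max = z.
Proof. by rewrite (tnth_nth z)/= nth_rcons size_tuple ltnn eqxx. Qed.

End tuples.

Section conformal_theory.
Context d (X : measurableType d) (R : realType).
Implicit Types (D : seq (X * R)) (z : X * R).
Variables (P : probability (X * R)%type R) (A : algorithm X R).
Hypothesis Asym : symmetric_algorithm A.
Hypothesis Ameas : measurable_fits A.

Definition residual D z : R := `|z.2 - A D z.1|.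

Lemma measurable_residual n (i : 'I_n) :
  measurable_fun setT (fun D : n.-tuple (X * R) => residual D (tnth D i)).
Proof.
apply: measurableT_comp; first exact: normr_measurable.
apply: measurable_funB; last exact: Ameas.
apply: measurableT_comp => //; exact: measurable_tnth.
Qed.

(** Symmetry for lists: the data sets compared below are built by appending,
    truncating and reindexing, and agree only up to order. *)
Lemma fit_perm D D' x : perm_eq D D' -> A D x = A D' x.
Proof.
move=> DD'; have sz := perm_size DD'.
have [/size0nil D0|D0] := posnP (size D').
  by move: sz; rewrite D0 => /size0nil ->.
have /tuple_permP[s ->] : perm_eq D (in_tuple D') by [].
by rewrite Asym.
Qed.

Lemma residual_perm D D' z : perm_eq D D' -> residual D z = residual D' z.
Proof. by move=> DD'; rewrite /residual (fit_perm _ DD'). Qed.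

Lemma perm_reindex_tuple n (s : 'S_n) (D : n.-tuple (X * R)) :
  perm_eq (reindex_tuple s D) D.
Proof. by apply/tuple_permP; exists s. Qed.

Section miscoverage.
Variables (alpha gamma : R) (n : nat).
Hypothesis alpha_lt1 : alpha < 1.
Hypothesis n_gt0 : (0 < n)%N.

Definition missed (D : n.-tuple (X * R)) z : bool :=
  (1 - alpha) * n.+1%:R <=
  #|[pred i : 'I_n |
     residual (rcons D z) (tnth D i) + gamma < residual (rcons D z) z]|%:R.

(** Being missed is a comparison of the residual of [z] with finitely many
    residuals of the same fit, all of which are random variables; this gives both
    the measurability of the miscoverage rate and the combinatorial form used in
    [miscoverage_lt]. *)
Lemma missedP (D : n.-tuple (X * R)) z :
  ~ conformal_set A alpha gamma D z.1 z.2 <-> missed D z.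
Proof.
have tauE : (1 - alpha) * (1 + n%:R^-1) * n%:R = (1 - alpha) * n.+1%:R :> R.
  by rewrite -mulrA [_ * n%:R]mulrDl mulVf ?pnatr_eq0 -?lt0n// mul1r natr1.
have tau0 : 0 < (1 - alpha) * (1 + n%:R^-1) * n%:R.
  by rewrite tauE mulr_gt0// subr_gt0.
rewrite /conformal_set/=.
have -> : (z.1, z.2) = z by case: z.
rewrite -[X in (X%:E <= _)%E]/(residual (rcons D z) z).
set Q := Quantile _ _.
have -> : missed D z <-> (Q < (residual (rcons D z) z - gamma)%:E)%E.
  rewrite /Q Quantile_ltP// tauE /missed.
  rewrite (_ : #|_| = #|[pred i : 'I_n |
     residual (rcons D z) (tnth D i) < residual (rcons D z) z - gamma]|)//.
  by apply: eq_card => i; rewrite !inE ltrBrDr.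
rewrite EFinB lteBrDr//.
by split => [/negP|?]; [rewrite -ltNge | apply/negP; rewrite -ltNge].
Qed.

Lemma measurable_missed d1 (T1 : measurableType d1)
    (f : T1 -> n.-tuple (X * R)) (g : T1 -> X * R) :
  measurable_fun setT f -> measurable_fun setT g ->
  measurable [set w | missed (f w) (g w)].
Proof.
move=> mf mg.
pose E w : n.+1.-tuple (X * R) := [tuple of rcons (f w) (g w)].
have mE : measurable_fun setT E by exact: measurable_rcons_tuple.
have mr i : measurable_fun setT (fun w => residual (E w) (tnth (E w) i)).
  exact: (measurableT_comp (measurable_residual i) mE).
rewrite (_ : [set w | _] = [set w | (1 - alpha) * n.+1%:R <=
   \sum_(i < n) \1_[set w | residual (E w) (tnth (E w) (widen_ord (leqnSn n) i)) + gamma <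
     residual (E w) (tnth (E w) ord_max)] w]).
  apply: measurable_count_le => i; apply: measurable_lt_set => //.
  exact: measurable_funD.
apply/funext => w /=; rewrite sum_indic_card; congr (is_true (_ <= _%:R)).
by apply: eq_card => i; rewrite !inE /E tnth_rcons_widen tnth_rcons_max.
Qed.

Lemma miscoverageE (D : n.-tuple (X * R)) :
  miscoverage P A alpha gamma D = P [set z | missed D z].
Proof.
by rewrite /miscoverage; congr (P _); apply/seteqP; split => z /=; rewrite missedP.
Qed.

Lemma measurable_miscoverage :
  measurable_fun setT (fun D : n.-tuple (X * R) => miscoverage P A alpha gamma D).
Proof.
have mM : measurable [set w : n.-tuple (X * R) * (X * R) | missed w.1 w.2].
  exact: measurable_missed.
rewrite (_ : (fun D : n.-tuple (X * R) => _) = P \o xsection [set w : n.-tuple (X * R) * (X * R) | missed w.1 w.2]).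
  exact: measurable_fun_xsection.
apply/funext => D /=; rewrite miscoverageE xsectionE; congr (P _).
Qed.

End miscoverage.
End conformal_theory.

(** * Conformal fits against the full fit *)

Section split_sample.
Context d (X : measurableType d) (R : realType).
Variables (P : probability (X * R)%type R) (A : algorithm X R).
Hypothesis Asym : symmetric_algorithm A.
Hypothesis Ameas : measurable_fits A.
Variables (n m : nat).
Implicit Types (D : (n + m).-tuple (X * R)) (j : 'I_m).

Definition train D : n.-tuple (X * R) := reindex_tuple (@lshift n m) D.
Definition augmented D j : n.+1.-tuple (X * R) :=
  [tuple of rcons (train D) (tnth D (rshift n j))].

Lemma measurable_augmented j : measurable_fun setT (augmented^~ j).
Proof.
by apply: measurable_rcons_tuple; [exact: measurable_reindex_tuple|exact: measurable_tnth].
Qed.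

Definition fit_change j (k : 'I_(n + m)) D : R :=
  `|A (augmented D j) (tnth D k).1 - A D (tnth D k).1|.

Lemma measurable_fit_change j (k : 'I_(n + m)) :
  (k < n)%N || (k == rshift n j) -> measurable_fun setT (fit_change j k).
Proof.
move=> kj.
have [i iE] : exists i, forall D, tnth D k = tnth (augmented D j) i.
  move/orP: kj => [kn|/eqP ->]; last by exists ord_max => D; rewrite tnth_rcons_max.
  exists (widen_ord (leqnSn n) (Ordinal kn)) => D.
  by rewrite tnth_rcons_widen tnth_mktuple; congr (tnth D _); exact: val_inj.
apply: measurableT_comp; first exact: normr_measurable.
apply: measurable_funB; last exact: Ameas.
rewrite (_ : (fun D => _) = (fun E : n.+1.-tuple (X * R) => A E (tnth E i).1) \o augmented^~ j).
  by apply: measurableT_comp; [exact: Ameas|exact: measurable_augmented].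
by apply/funext => D /=; rewrite iE.
Qed.

Lemma take_reindex_perm j (s : 'S_(n + m)) D :
  (forall x : 'I_(n + m), ((s x < n)%N || (s x == rshift n j)) = (x <= n)%N) ->
  perm_eq (take n.+1 (reindex_tuple s D)) (augmented D j).
Proof.
move=> sP.
pose l := map s (take n.+1 (enum 'I_(n + m))).
pose l' := rcons (map (@lshift n m) (enum 'I_n)) (rshift n j).
have -> : take n.+1 (reindex_tuple s D) = map (tnth D) l.
  by rewrite /= -map_take -map_comp.
have -> : augmented D j = map (tnth D) l' :> seq _.
  by rewrite /= map_rcons -map_comp.
apply: perm_map; apply: uniq_perm.
- by rewrite (map_inj_uniq perm_inj) take_uniq// enum_uniq.
- rewrite rcons_uniq (map_inj_uniq (@lshift_inj _ _)) enum_uniq andbT.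
  by apply/negP => /mapP[i _ /eqP]; rewrite eq_sym eq_lrshift.
move=> y; rewrite mem_rcons inE.
have -> : (y \in l) = (s^-1%g y <= n)%N.
  rewrite -{1}[y](permKV s) (mem_map perm_inj).
  by rewrite in_take ?mem_enum// index_enum_ord.
rewrite -sP permKV orbC; congr (_ || _).
apply/idP/mapP => [yn|[i _ ->]]; last by rewrite /= ltn_ord.
by exists (Ordinal yn); rewrite ?mem_enum//; exact: val_inj.
Qed.

(** In-sample stability refers to the first point of the sample, evaluated by the
    fit on the first [n.+1] points. A permutation of the sample that sends
    position 0 to [k] and the first [n.+1] positions to the training positions
    and [j] turns this into the pair of fits compared here, because the
    algorithm does not see the order of the points. *)
Lemma integral_fit_change j (k : 'I_(n + m)) : (k < n)%N || (k == rshift n j) ->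
  (\int[iid_law P (n + m)]_D (fit_change j k D)%:E = beta_in A P (m - 1) (n + 1))%E.
Proof.
move=> kj.
have m0 : (0 < m)%N by exact: leq_ltn_trans (ltn_ord j).
have nN : (n < n + m)%N by rewrite -[X in (X < _)%N]addn0 ltn_add2l.
have N0 : (0 < n + m)%N by rewrite (leq_ltn_trans _ nN).
pose F (t : seq (X * R)) : \bar R :=
  if t is z1 :: _ then `|A (take (n + 1) t) z1.1 - A t z1.1|%R%:E else 0%E.
have -> : beta_in A P (m - 1) (n + 1) = (\int[iid_law P (n + m)]_D F D)%E.
  have NE : (n + 1 + (m - 1) = n + m)%N by rewrite -addnA subnKC.
  rewrite -[LHS]/(\int[iid_law P (n + 1 + (m - 1))]_D F D)%E.
  by rewrite NE.
pose o0 : 'I_(n + m) := Ordinal N0.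
pose on : 'I_(n + m) := Ordinal nN.
have FE (E : (n + m).-tuple (X * R)) :
    F E = `|A (take n.+1 E) (tnth E o0).1 - A E (tnth E o0).1|%:E.
  rewrite /F addn1; case: E => -[/= sz|z t sz].
    by exfalso; have := N0; rewrite -(eqP sz).
  by rewrite (tnth_nth z).
(* s exchanges n with the test position j, after moving 0 to the position
   among the first n.+1 that ends up at k. *)
pose k0 : 'I_(n + m) := if (k < n)%N then k else on.
have k0n : (k0 <= n)%N by rewrite /k0; case: ifP => //= /ltnW.
pose s : 'S_(n + m) := (tperm o0 k0 * tperm on (rshift n j))%g.
have s0 : s o0 = k.
  rewrite permM tpermL /k0; case: ifP => kn.
    by rewrite tpermD//; apply/eqP => /(congr1 val) /= kE; move: kn; rewrite -kE ?ltnn// ltnNge leq_addr.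
  by rewrite tpermL; move: kj; rewrite kn/= => /eqP.
have sP (x : 'I_(n + m)) : ((s x < n)%N || (s x == rshift n j)) = (x <= n)%N.
  have -> : (x <= n)%N = (tperm o0 k0 x <= n)%N by case: tpermP => // ->; rewrite ?k0n.
  rewrite permM; set y := tperm o0 k0 x.
  case: tpermP => [->|->|/eqP yn /eqP yj].
  - by rewrite eqxx orbT /= leqnn.
  - rewrite /= ltnn/= -val_eqE/=.
    by rewrite eqn_leq leq_addr.
  - by rewrite (negbTE yj) orbF [RHS]leq_eqVlt; move: yn; rewrite -val_eqE/= => /negbTE ->.
have Fs D : F (reindex_tuple s D) = (fit_change j k D)%:E.
  rewrite FE /fit_change tnth_mktuple s0 (fit_perm Asym _ (take_reindex_perm _ sP)).
  by rewrite (fit_perm Asym _ (perm_reindex_tuple _ _)).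
(* Measurability is known for fit_change, so F is handled through s^-1. *)
have FV D : F D = (fit_change j k (reindex_tuple s^-1%g D))%:E.
  rewrite -Fs; congr (F (tval _)).
  by apply: eq_from_tnth => i; rewrite !tnth_mktuple permK.
under [RHS]eq_integral do rewrite FV.
rewrite (ge0_integral_iid_reindex P s^-1%g (f := EFin \o fit_change j k))//.
- by apply/measurable_EFinP; exact: measurable_fit_change.
- by move=> D; rewrite lee_fin normr_ge0.
Qed.

End split_sample.

(** * The exceptional events *)

Section events.
Context d (X : measurableType d) (R : realType).
Variables (P : probability (X * R)%type R) (A : algorithm X R).
Hypothesis Asym : symmetric_algorithm A.
Hypothesis Ameas : measurable_fits A.
Variables (n m : nat).
Implicit Types (D : (n + m).-tuple (X * R)) (j : 'I_m).
Local Notation N := (n + m)%N.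
Local Notation Q := (iid_law P N).

Section miss.
Variables (alpha gamma s : R).
Hypothesis alpha_lt1 : alpha < 1.
Hypothesis n_gt0 : (0 < n)%N.
Local Notation risk E := (fine (miscoverage P A alpha gamma E)).

Definition many_test_covered : set (N.-tuple (X * R)) :=
  [set D | (1 - risk (train D) + s) * m%:R <=
    #|[pred j | ~~ missed A alpha gamma (train D) (tnth D (rshift n j))]|%:R].

Lemma miscoverage_fin (E : n.-tuple (X * R)) :
  miscoverage P A alpha gamma E = (risk E)%:E /\ 0 <= risk E <= 1.
Proof.
have mM : measurable [set z | missed A alpha gamma E z] by exact: measurable_missed.
rewrite miscoverageE//; split; first by rewrite fineK// fin_num_measure.
by rewrite -!lee_fin fineK ?fin_num_measure// measure_ge0 probability_le1.
Qed.

Lemma measurable_many_test_covered : measurable many_test_covered.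
Proof.
have mt : measurable_fun setT (@train _ X R n m) by exact: measurable_reindex_tuple.
rewrite (_ : many_test_covered = [set D | (1 - risk (train D) + s) * m%:R <=
    \sum_j \1_[set D | ~~ missed A alpha gamma (train D) (tnth D (rshift n j))] D]).
  apply: measurable_le_set.
    apply: measurable_funM => //; apply: measurable_funD => //.
    apply: measurable_funB => //.
    apply: (measurableT_comp (fine_measurable measurableT)) => //.
    apply: (measurableT_comp (measurable_miscoverage _ _ _ _ _)) => //.
  apply: measurable_sum => j; apply: measurable_indic.
  rewrite (_ : [set _ | _] = ~` [set D | missed A alpha gamma (train D) (tnth D (rshift n j))]).
    apply: measurableC; apply: measurable_missed => //; exact: measurable_tnth.
  by apply/seteqP; split => D /= /negP.
by apply/funext => D /=; rewrite sum_indic_card.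
Qed.

(** Given the training set, the test points are covered independently, each with
    probability one minus the miscoverage rate. *)
Lemma many_test_covered_le : 0 <= s ->
  (Q many_test_covered <= (expR (- (2 * s ^+ 2 * m%:R)))%:E)%E.
Proof.
move=> s0; rewrite iid_law_cat; last exact: measurable_many_test_covered.
have mW : measurable (@cat_pair _ (X * R)%type n m @^-1` many_test_covered).
  rewrite -[X in measurable X]setTI; apply: measurable_cat_pair => //.
  exact: measurable_many_test_covered.
set W := _ @^-1` _ in mW *.
set c := expR _.
apply: (@le_trans _ _ (\int[iid_law P n]_E c%:E)%E); last first.
  rewrite integral_cst// -[leLHS]/(c%:E * iid_law P n setT)%E.
  by rewrite probability_setT mule1.
apply: (@ge0_le_integral _ _ _ (iid_law P n) _ measurableT
    (iid_law P m \o xsection W) (cst c%:E)) => //.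
  exact: measurable_fun_xsection.
move=> E _ /=.
have [riskE /andP[r0 r1]] := miscoverage_fin E.
pose B j := [set E' : m.-tuple (X * R) | ~~ missed A alpha gamma E (tnth E' j)].
have mB j : measurable (B j).
  rewrite (_ : B j = ~` [set E' | missed A alpha gamma E (tnth E' j)]).
    apply: measurableC; apply: measurable_missed => //; exact: measurable_tnth.
  by apply/seteqP; split => D /= /negP.
pose cov := [set z | ~~ missed A alpha gamma E z].
have covE : cov = ~` [set z | missed A alpha gamma E z].
  by apply/seteqP; split => D /= /negP.
have mcov : measurable cov.
  by rewrite covE; apply: measurableC; apply: measurable_missed.
have Pcov : P cov = (1 - risk E)%:E.
  rewrite covE probability_setC; last exact: measurable_missed.
  by rewrite -miscoverageE// riskE.
have -> : xsection W E =
    [set E' | (1 - risk E + s) * #|'I_m|%:R <= \sum_j \1_(B j) E'].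
  have trE (E' : m.-tuple (X * R)) : train (cat_pair (E, E')) = E.
    by apply: eq_from_tnth => i; rewrite tnth_mktuple tnth_lshift.
  rewrite xsectionE; apply/funext => E' /=.
  rewrite sum_indic_card /W /many_test_covered /= trE card_ord.
  congr (is_true (_ <= _%:R)); apply: eq_card => j.
  by rewrite !inE tnth_rshift.
rewrite /c -[m in leRHS]card_ord; apply: negative_chernoff => //.
  by rewrite subr_ge0 r1 lerBlDr lerDl r0.
move=> J.
rewrite (_ : [set _ | _] = [set E' | forall i, (if i \in J then cov else setT) (tnth E' i)]).
  rewrite (iid_law_box P (B := fun i => if i \in J then cov else setT)); last first.
    by move=> i; case: ifP.
  rewrite -prodr_const [X in (_ <= X%:E)%E]big_mkcond/= -prodEFin.
  rewrite le_eqVlt (eq_bigr (fun i => (if i \in J then 1 - risk E else 1)%:E)) ?eqxx//.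
  by move=> i _; case: ifP => _; rewrite ?Pcov ?probability_setT.
apply/seteqP; split => E' /= h i.
  by have := h i; case: ifP => // _; exact.
by have := h i; case: ifP.
Qed.

End miss.
End events.

Section rank_and_stability_events.
Context d (X : measurableType d) (R : realType).
Variables (P : probability (X * R)%type R) (A : algorithm X R).
Hypothesis Asym : symmetric_algorithm A.
Hypothesis Ameas : measurable_fits A.
Variables (n m : nat).
Implicit Types (D : (n + m).-tuple (X * R)) (j : 'I_m).
Local Notation N := (n + m)%N.
Local Notation Q := (iid_law P N).

(** The fit on the whole sample treats training and test points alike, so its
    residuals are exchangeable over all of them; those of a conformal fit are so
    only over the training points and one test point. *)
Definition full_residual D (k : 'I_N) : R := residual A D (tnth D k).

Lemma measurable_full_residual k : measurable_fun setT (full_residual^~ k).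
Proof. exact: measurable_residual. Qed.

Lemma full_residual_reindex (s : 'S_N) D k :
  full_residual (reindex_tuple s D) k = full_residual D (s k).
Proof.
rewrite /full_residual tnth_mktuple; apply: (residual_perm Asym).
exact: perm_reindex_tuple.
Qed.

Section rank_events.
Variables p s : R.

Definition high_rank D (k : 'I_N) : bool :=
  #|[pred l | full_residual D k <= full_residual D l]|%:R <= p * N%:R.

Definition low_rank D (k : 'I_N) : bool :=
  p * N%:R <= #|[pred l | full_residual D k < full_residual D l]|%:R.

Definition many_test_high : set (N.-tuple (X * R)) :=
  [set D | (p + s) * m%:R <= #|[pred j : 'I_m | high_rank D (rshift n j)]|%:R].

Definition many_train_low : set (N.-tuple (X * R)) :=
  [set D | (1 - p + s) * n%:R <= #|[pred i : 'I_n | low_rank D (lshift m i)]|%:R].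

Let many_test_highE : many_test_high = [set D | (p + s) * m%:R <=
  \sum_(j < m) \1_[set D | high_rank D (rshift n j)] D].
Proof. by apply/funext => D /=; rewrite sum_indic_card. Qed.

Let many_train_lowE : many_train_low = [set D | (1 - p + s) * n%:R <=
  \sum_(i < n) \1_[set D | low_rank D (lshift m i)] D].
Proof. by apply/funext => D /=; rewrite sum_indic_card. Qed.

Lemma measurable_high_rank k : measurable [set D | high_rank D k].
Proof.
rewrite (_ : [set _ | _] = [set D |
  \sum_l \1_[set D | full_residual D k <= full_residual D l] D <= p * N%:R]).
  apply: measurable_le_set => //; apply: measurable_sum => l.
  by apply: measurable_indic; apply: measurable_le_set; exact: measurable_full_residual.
by apply/funext => D /=; rewrite sum_indic_card.
Qed.

Lemma measurable_low_rank k : measurable [set D | low_rank D k].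
Proof.
rewrite (_ : [set _ | _] = [set D | p * N%:R <=
  \sum_l \1_[set D | full_residual D k < full_residual D l] D]).
  apply: measurable_count_le => l.
  by apply: measurable_lt_set; exact: measurable_full_residual.
by apply/funext => D /=; rewrite sum_indic_card.
Qed.

Lemma measurable_many_test_high : measurable many_test_high.
Proof.
by rewrite many_test_highE; apply: measurable_count_le => j; exact: measurable_high_rank.
Qed.

Lemma measurable_many_train_low : measurable many_train_low.
Proof.
by rewrite many_train_lowE; apply: measurable_count_le => i; exact: measurable_low_rank.
Qed.

Lemma high_rank_reindex (t : 'S_N) D k :
  high_rank (reindex_tuple t D) k = high_rank D (t k).
Proof.
congr (_%:R <= _); rewrite -!sum1_card [RHS](reindex_inj (@perm_inj _ t)).
by apply: eq_bigl => l; rewrite !inE !full_residual_reindex.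
Qed.

Lemma low_rank_reindex (t : 'S_N) D k :
  low_rank (reindex_tuple t D) k = low_rank D (t k).
Proof.
congr (_ <= _%:R); rewrite -!sum1_card [RHS](reindex_inj (@perm_inj _ t)).
by apply: eq_bigl => l; rewrite !inE !full_residual_reindex.
Qed.

Hypotheses (p01 : 0 <= p <= 1) (s_ge0 : 0 <= s).

Lemma many_test_high_le :
  (Q many_test_high <= (expR (- (2 * s ^+ 2 * m%:R)))%:E)%E.
Proof.
have /andP[p0 p1] := p01; rewrite many_test_highE.
apply: (exchangeable_chernoff P (b := fun k => [set D | high_rank D k])) => //;
  last exact: rshift_inj.
- exact: measurable_high_rank.
- by move=> t k D /=; rewrite high_rank_reindex.
- by move=> D; rewrite sum_indic_card; apply: card_upper_rank_le; rewrite mulr_ge0.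
Qed.

Lemma many_train_low_le :
  (Q many_train_low <= (expR (- (2 * s ^+ 2 * n%:R)))%:E)%E.
Proof.
have /andP[p0 p1] := p01; rewrite many_train_lowE.
apply: (exchangeable_chernoff P (b := fun k => [set D | low_rank D k])) => //;
  last exact: lshift_inj.
- exact: measurable_low_rank.
- by move=> t k D /=; rewrite low_rank_reindex.
- move=> D; rewrite sum_indic_card mulrBl mul1r -[X in _ <= X%:R - _](card_ord N).
  by apply: card_lower_rank_le; rewrite card_ord ler_piMl.
- by rewrite subr_ge0 p1 lerBlDr lerDl p0.
Qed.

End rank_events.

Section stability.
Variable gamma : R.
Hypothesis gamma_gt0 : 0 < gamma.

Definition unstable D j (i : 'I_n) : bool :=
  gamma <= fit_change A j (lshift m i) D + fit_change A j (rshift n j) D.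

Let mfc_train j (i : 'I_n) : measurable_fun setT (fit_change A j (lshift m i)).
Proof. by apply: measurable_fit_change => //; rewrite /= ltn_ord. Qed.

Let mfc_test j : measurable_fun setT (fit_change A j (rshift n j)).
Proof. by apply: measurable_fit_change => //; rewrite eqxx orbT. Qed.

Lemma measurable_unstable j i : measurable [set D | unstable D j i].
Proof. by apply: measurable_le_set => //; exact: measurable_funD. Qed.

(** Each of the two changes has expectation [beta_in]. *)
Lemma unstable_le j i :
  (Q [set D | unstable D j i] <= (2 / gamma)%:E * beta_in A P (m - 1) (n + 1))%E.
Proof.
pose f D := fit_change A j (lshift m i) D + fit_change A j (rshift n j) D.
have f0 D : 0 <= f D by rewrite addr_ge0 ?normr_ge0.
have mf : measurable_fun setT (EFin \o f).
  by apply/measurable_EFinP; exact: measurable_funD.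
rewrite mulrC EFinM -muleA lee_pdivlMl//.
have := @le_integral_abse _ _ _ Q _ measurableT _ _ mf gamma_gt0; rewrite setTI.
rewrite (_ : [set w | (gamma%:E <= `|(EFin \o f) w|)%E] = [set D | unstable D j i]); last first.
  by apply/seteqP; split => w /=; rewrite lee_fin ger0_norm.
move=> /le_trans; apply.
under eq_integral do rewrite /= ger0_norm// /f EFinD.
rewrite ge0_integralD//; last 4 first.
- by move=> D _; rewrite lee_fin normr_ge0.
- by apply/measurable_EFinP.
- by move=> D _; rewrite lee_fin normr_ge0.
- by apply/measurable_EFinP.
rewrite !integral_fit_change//; last 2 first.
- by rewrite eqxx orbT.
- by rewrite /= ltn_ord.
by rewrite -mule2n mule_natl.
Qed.

Definition many_unstable (e : R) : set (N.-tuple (X * R)) :=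
  [set D | e ^+ 2 * (m%:R * n%:R) < \sum_(j < m) #|[pred i | unstable D j i]|%:R].

Let B (x : 'I_m * 'I_n) := [set D | unstable D x.1 x.2].

Let mB x : measurable (B x). Proof. exact: measurable_unstable. Qed.

Let sum_unstableE D :
  \sum_(j < m) #|[pred i | unstable D j i]|%:R = \sum_x \1_(B x) D :> R.
Proof.
rewrite -(pair_big xpredT xpredT (fun j i => \1_(B (j, i)) D))/=.
apply: eq_bigr => j _.
by rewrite -[RHS]/(\sum_i \1_[set D | unstable D j i] D) sum_indic_card.
Qed.

Lemma measurable_many_unstable e : measurable (many_unstable e).
Proof.
rewrite (_ : many_unstable e =
    [set D | e ^+ 2 * (m%:R * n%:R) < \sum_x \1_(B x) D]); last first.
  by apply/funext => D /=; rewrite -sum_unstableE.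
apply: measurable_lt_set => //.
by apply: measurable_sum => x; exact: measurable_indic.
Qed.

(** The three powers of [e] are spent as follows: an unstable pair has probability
    [e ^+ 3], so the proportion of such pairs exceeds [e ^+ 2] with probability
    at most [e]. *)
Lemma many_unstable_le (e : R) : (0 < n)%N -> (0 < m)%N -> 0 <= e ->
  (forall j i, (Q [set D | unstable D j i] <= (e ^+ 3)%:E)%E) ->
  (Q (many_unstable e) <= e%:E)%E.
Proof.
move=> n0 m0 e0 Qun; have mS := measurable_many_unstable e.
have cI : #|{: 'I_m * 'I_n}|%:R = m%:R * n%:R :> R by rewrite card_prod !card_ord natrM.
(* For e = 0 the event says that some pair is unstable: count at least 1. *)
have [ez|en0] := eqVneq e 0.
  apply: (@le_trans _ _ (Q [set D | 1 <= \sum_x \1_(B x) D])).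
    apply: le_measure; rewrite ?inE//; first exact: measurable_count_le.
    move=> D; rewrite /many_unstable /= ez expr0n mul0r -sum_unstableE -natr_sum.
    by rewrite ltr0n ler1n.
  apply: le_trans (markov_count mB ltr01 (fun x => Qun x.1 x.2)) _.
  by rewrite ez expr0n/= !mulr0.
have e_gt0 : 0 < e by rewrite lt_neqAle eq_sym en0.
have c0 : 0 < e ^+ 2 * (m%:R * n%:R) by rewrite !mulr_gt0 ?exprn_gt0 ?ltr0n.
apply: (@le_trans _ _ (Q [set D | e ^+ 2 * (m%:R * n%:R) <= \sum_x \1_(B x) D])).
  apply: le_measure; rewrite ?inE//; first exact: measurable_count_le.
  by move=> D; rewrite /many_unstable /= sum_unstableE => /ltW.
apply: le_trans (markov_count mB c0 (fun x => Qun x.1 x.2)) _.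
rewrite lee_fin ler_pdivrMl// cI le_eqVlt; apply/orP; left; apply/eqP; ring.
Qed.

End stability.
End rank_and_stability_events.

(** * The training-conditional bound *)

Section deterministic.
Context d (X : measurableType d) (R : realType).
Variables (P : probability (X * R)%type R) (A : algorithm X R).
Variables (n m : nat) (alpha gamma e s : R).
Hypotheses (n_gt0 : (0 < n)%N) (m_gt0 : (0 < m)%N).
Hypotheses (alpha_lt1 : alpha < 1) (e_ge0 : 0 <= e).
Local Notation risk E := (fine (miscoverage P A alpha gamma E)).

(** Outside the four exceptional events, a missed test point either has more than
    [e * n] unstable partners, or its full residual is among the upper
    [(alpha + e)]-part of the training residuals; the first kind makes up a
    fraction at most [e] of the test points, the second less than
    [alpha + e + 2 * s], and the miscoverage rate is less than the observed frequency
    of missed points plus [s]. *)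
Lemma miscoverage_lt (D : (n + m).-tuple (X * R)) :
  let p := alpha + e + s in
  ~ many_test_covered P A alpha gamma s D ->
  ~ many_test_high A p s D -> ~ many_train_low A p s D ->
  ~ many_unstable A gamma e D ->
  risk (train D) < alpha + 3 * s + 2 * e.
Proof.
move=> p /negP; rewrite /many_test_covered /= -ltNge => hits.
move=> /negP; rewrite /many_test_high /= -ltNge => upper.
move=> /negP; rewrite /many_train_low /= -ltNge => lower.
move=> /negP; rewrite /many_unstable /= -leNgt => stable.
pose M := [pred j | missed A alpha gamma (train D) (tnth D (rshift n j))].
pose H := [pred j : 'I_m | e * n%:R < #|[pred i | unstable A gamma D j i]|%:R].
pose E := [pred j : 'I_m | #|[pred i : 'I_n |
   full_residual A D (rshift n j) <= full_residual A D (lshift m i)]|%:R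
     <= (p - s) * n%:R].
have cardH : #|H|%:R <= e * m%:R by exact: card_heavy_le.
have cardE : #|E|%:R < (p + s) * m%:R by exact: card_test_exceed_lt.
have MHE : #|M|%:R <= #|H|%:R + #|E|%:R :> R.
  rewrite -natrD ler_nat -cardUI (leq_trans _ (leq_addr _ _))//.
  apply: subset_leq_card; apply/fintype.subsetP => j; rewrite !inE => jM.
  rewrite -implyNb -leNgt; apply/implyP => jH.
  rewrite (_ : p - s = alpha + e); last by rewrite /p; ring.
  apply: (@card_exceed_perturb _ _
    (fun i => residual A (augmented D j) (tnth D (lshift m i))) _
    (residual A (augmented D j) (tnth D (rshift n j))) _
    (fun i => fit_change A j (lshift m i) D) (fit_change A j (rshift n j) D) gamma) => //.
  - move=> i; apply: le_trans (ler_dist_dist _ _) _.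
    by rewrite opprB addrC addrA subrK distrC.
  - apply: le_trans (ler_dist_dist _ _) _.
    by rewrite opprB addrC addrA subrK distrC.
  - move: jM; rewrite /missed; congr (is_true (_ <= _%:R)).
    by apply: eq_card => i; rewrite !inE tnth_mktuple.
  - by rewrite subr_ge0 ltW.
have cardM : #|[pred j | ~~ missed A alpha gamma (train D) (tnth D (rshift n j))]|%:R
    = m%:R - #|M|%:R :> R.
  rewrite -[X in X%:R - _](card_ord m) -(cardC M) natrD addrAC subrr add0r.
  by congr _%:R; apply: eq_card => j; rewrite !inE.
move: hits; rewrite cardM => hits.
have mR : 0 < m%:R :> R by rewrite ltr0n.
rewrite -(ltr_pM2r mR).
have -> : (alpha + 3 * s + 2 * e) * m%:R = e * m%:R + (p + s) * m%:R + s * m%:R.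
  by rewrite /p; ring.
move: hits; rewrite mulrDl mulrBl mul1r; lra.
Qed.

End deterministic.

(** The deviation makes Hoeffding's bound equal to [delta] at sample size [k], and
    the bound decreases with the sample size. *)
Lemma expR_deviation_le (R : realType) (delta : R) (k k' : nat) :
  0 < delta < 1 -> (0 < k)%N -> (k <= k')%N ->
  expR (- (2 * Num.sqrt (ln (1 / delta) / (2 * k%:R)) ^+ 2 * k'%:R)) <= delta.
Proof.
move=> /andP[d0 d1] k0 kk'.
have kR : 0 < k%:R :> R by rewrite ltr0n.
have L0 : 0 <= ln (1 / delta) by rewrite ln_ge0// ler_pdivlMr// mul1r ltW.
rewrite sqr_sqrtr; last by rewrite divr_ge0// mulr_ge0.
rewrite -[leRHS]lnK ?posrE// ler_expR.
have -> : ln delta = - ln (1 / delta) by rewrite div1r lnV ?posrE// opprK.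
rewrite lerN2.
have -> : 2 * (ln (1 / delta) / (2 * k%:R)) * k'%:R = ln (1 / delta) * (k'%:R / k%:R).
  by field; rewrite gt_eqF.
by rewrite ler_peMr// ler_pdivlMr// mul1r ler_nat.
Qed.

Unset Implicit Arguments.

Theorem theorem3p5 (R : realType) (d : measure_display) (X : measurableType d)
    (alpha : R) (halpha : 0 < alpha < 1)
    (P : probability (X * R)%type R)
    (A : algorithm X R) (hsym : symmetric_algorithm A)
    (hmeas : measurable_fits A)
    (n : nat) (hn : (1 <= n)%N) (gamma : R) (hgamma : 0 < gamma)
    (m : nat) (hm : (1 <= m)%N) (delta : R) (hdelta : 0 < delta < 1) :
  let err : \bar R :=
    (((2 / gamma)%:E * beta_in A P (m - 1) (n + 1)) `^ (1 / 3))%E in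
  ((1 - 3 * delta)%:E - err <=
   iid_law P n
     [set D | miscoverage P A alpha gamma D <
       (alpha + 3 * Num.sqrt (ln (1 / delta) / (2 * (minn n m)%:R)))%:E
       + 2%:E * err])%E.
Proof.
cbv zeta; set err := (_ `^ _)%E; set s := Num.sqrt _.
have [a0 a1] := andP halpha; have [d0 d1] := andP hdelta.
have s0 : 0 <= s by exact: sqrtr_ge0.
have beta0 : (0 <= (2 / gamma)%:E * beta_in A P (m - 1) (n + 1))%E.
  apply: mule_ge0; first by rewrite lee_fin divr_ge0// ltW.
  by apply: integral_ge0 => D _; case: (tval D) => // z ?; rewrite lee_fin.
have [[c c0 cE]|ErrE] : (exists2 c, 0 <= c &
    ((2 / gamma)%:E * beta_in A P (m - 1) (n + 1) = c%:E)%E) \/ err = +oo%E.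
- move: beta0; rewrite /err; case: (_ * _)%E => [c c0| |//].
  + by left; exists c.
  + by right; rewrite poweRyr// gt_eqF// divr_gt0.
- pose e := c `^ (1 / 3).
  have e0 : 0 <= e by exact: powR_ge0.
  have eE : err = e%:E by rewrite /err cE poweR_EFin.
  have e3 : e ^+ 3 = c.
    by rewrite -powR_mulrn// -powRrM div1r mulVf// powRr1.
  rewrite eE -EFinB -EFinM -EFinD.
  set t := alpha + 3 * s + 2 * e.
  set G := [set D | _].
  have mG : measurable G.
    rewrite -[G]setTI; apply: emeasurable_fun_infty_o => //.
    exact: measurable_miscoverage.
  have riskE := miscoverage_fin P hmeas gamma a1 hn.
  have GE E : G E <-> fine (miscoverage P A alpha gamma E) < t.
    by rewrite /G /= (riskE E).1 lte_fin.
  pose p := alpha + e + s.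
  have p0 : 0 <= p by rewrite !addr_ge0// ltW.
  (* For p > 1 the threshold exceeds 1 and the event is certain. *)
  have [p1|p1] := leP p 1; last first.
    rewrite (_ : G = setT) ?probability_setT ?lee_fin; first by lra.
    apply/seteqP; split => // E _; apply/GE.
    by have [_ /andP[_]] := riskE E; move: p1; rewrite /p /t; lra.
  have p01 : 0 <= p <= 1 by rewrite p0.
  pose W1 := many_test_covered P A alpha gamma (n := n) (m := m) s.
  pose W2 := many_test_high A (n := n) (m := m) p s.
  pose W3 := many_train_low A (n := n) (m := m) p s.
  pose W4 := many_unstable A (n := n) (m := m) gamma e.
  have dev k : (minn n m <= k)%N -> expR (- (2 * s ^+ 2 * k%:R)) <= delta.
    by apply: expR_deviation_le => //; rewrite leq_min hn.
  have QW1 : (iid_law P (n + m) W1 <= delta%:E)%E.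
    apply: le_trans (many_test_covered_le P hmeas m gamma a1 hn s0) _.
    by rewrite lee_fin dev// geq_minr.
  have QW2 : (iid_law P (n + m) W2 <= delta%:E)%E.
    apply: le_trans (many_test_high_le P hsym hmeas n m p01 s0) _.
    by rewrite lee_fin dev// geq_minr.
  have QW3 : (iid_law P (n + m) W3 <= delta%:E)%E.
    apply: le_trans (many_train_low_le P hsym hmeas n m p01 s0) _.
    by rewrite lee_fin dev// geq_minl.
  have QW4 : (iid_law P (n + m) W4 <= e%:E)%E.
    apply: many_unstable_le => // j i.
    by rewrite e3 -cE; exact: unstable_le.
  have mW1 : measurable W1 by exact: measurable_many_test_covered.
  have mW2 : measurable W2 by exact: measurable_many_test_high.
  have mW3 : measurable W3 by exact: measurable_many_train_low.
  have mW4 : measurable W4 by exact: measurable_many_unstable.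
  have bad : reindex_tuple (@lshift n m) @^-1` (~` G) `<=` W1 `|` W2 `|` (W3 `|` W4).
    move=> D /= nG; apply: contrapT => nW; apply: nG; apply/GE.
    apply: miscoverage_lt => //.
    - by move=> w1; apply: nW; left; left.
    - by move=> w2; apply: nW; left; right.
    - by move=> w3; apply: nW; right; left.
    - by move=> w4; apply: nW; right; right.
  have mpre : measurable (reindex_tuple (@lshift n m) @^-1` (~` G)).
    rewrite -[X in measurable X]setTI; apply: measurable_reindex_tuple => //.
    exact: measurableC.
  have QG : (iid_law P n (~` G) <= (delta + delta + (delta + e))%:E)%E.
    rewrite -(iid_law_lshift P m); last exact: measurableC.
    apply: (@le_trans _ _ (iid_law P (n + m) (W1 `|` W2 `|` (W3 `|` W4)))).
      by apply: le_measure; rewrite ?inE//; do 2?apply: measurableU => //.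
    rewrite EFinD [(delta + delta)%:E]EFinD [(delta + e)%:E]EFinD.
    apply: le_trans (measureU2 _ _ _) _; [exact: measurableU|exact: measurableU|].
    by apply: leeD; apply: le_trans (measureU2 _ _ _) _ => //; exact: leeD.
  rewrite -[G]setCK probability_setC; last exact: measurableC.
  rewrite leeBrDr ?fin_num_measure//; last exact: measurableC.
  apply: le_trans (leeD (lexx _) QG) _.
  rewrite -EFinD lee_fin; lra.
by rewrite ErrE /= leNye.
Qed.
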